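(* Let $d$ be a positive integer. Let $V$ be a positive random variable, let $U$ be a $d$-dimensional random vector with strictly positive density $f$ on $\mathbb{R}^d$, and let $Y=(Y(t))_{t\in\mathbb{R}}$ be a real-valued, zero mean stationary (measurable) random process with covariance function $t\mapsto e^{-t^2}$; assume $V$, $U$, $Y$ are independent. Let $S_x\in\mathbb{R}^{d\times d}$ be a strictly positive definite (symmetric) matrix for every $x\in\mathbb{R}^d$, let $\xi_2:\mathbb{R}^d\to\mathbb{R}$ be arbitrary, let $g$ be a positive function on $(0,\infty)\times\mathbb{R}^d$ (measurable in its first argument) such that $\mathbb{E}_V\, g(V,x)^2<\infty$ for all $x\in\mathbb{R}^d$, and let $\xi_1(x)=x^\top Mx+z^\top x$ for a symmetric matrix $M\in\mathbb{R}^{d\times d}$ and a vector $z\in\mathbb{R}^d$. For $x\in\mathbb{R}^d$ define $$Z(x)=(2V/\pi)^{d/4}\,|S_x|^{1/4}\,e^{-V(U-x)^\top S_x(U-x)}\,Y\!\left(\sqrt V\,\big(\xi_1(U-x)+\xi_2(x)\big)\right)\frac{g(V,x)}{\sqrt{f(U)}}.$$ For $x,y\in\mathbb{R}^d$ let $$c=-z^\top(x-y)+\xi_2(x)-\xi_2(y),\qquad A=S_x+S_y+4M(x-y)(x-y)^\top M,\qquad m=(x-y)^\top M(x-y),$$ and $$Q(x,y)=c^2-m^2+(x-y)^\top\big(S_x+2(m+c)M\big)A^{-1}\big(S_y+2(m-c)M\big)(x-y).$$ Then the covariance function of $Z$ equals $$C(x,y)=\frac{2^{d/2}|S_x|^{1/4}|S_y|^{1/4}}{\sqrt{|A|}}\;\mathbb{E}_V\,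 g(V,x)\,g(V,y)\exp(-V\,Q(x,y)),\qquad x,y\in\mathbb{R}^d.$$
   Context: $|B|$ denotes the determinant of a square matrix $B$, and $\mathbb{E}_V$ denotes expectation with respect to the random variable $V$. The covariance function of $Z$ is $C(x,y)=\mathrm{Cov}(Z(x),Z(y))$. A real symmetric matrix $B$ is strictly positive definite if $v^\top Bv>0$ for all $v\ne0$.
   Formalization: The measurability and independence of Y are read jointly: Y is jointly measurable in time and outcome with respect to a sigma-algebra that is, together with V and U, independent; with mere joint measurability and independence of the variables Y(t) the claim can fail. *)

(* Defs.v *)
From HB Require Import structures.
From mathcomp Require Import all_boot all_order all_algebra.
From mathcomp Require Import all_classical all_reals all_analysis.

Set Implicit Arguments.
Unset Strict Implicit.
Unset Printing Implicit Defensive.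

Import Order.TTheory GRing.Theory Num.Theory.
Import numFieldNormedType.Exports.

Local Open Scope classical_set_scope.
Local Open Scope ring_scope.

(* R^n is 'cV[R]_n, with the product (equivalently Borel) sigma-algebra. *)
Section measurable_cV.
Context {R : realType}.
Variable n : nat.

Let coord : 'I_n -> 'cV[R]_n -> R := fun i u => u i ord0.

Let cV_set0 : g_sigma_preimage coord set0.
Proof. exact: sigma_algebra0. Qed.

Let cV_setC A : g_sigma_preimage coord A -> g_sigma_preimage coord (~` A).
Proof. exact: sigma_algebraC. Qed.

Let cV_bigcup (F : (set 'cV[R]_n)^nat) :
  (forall i, g_sigma_preimage coord (F i)) ->
  g_sigma_preimage coord (\bigcup_i F i).
Proof. exact: sigma_algebra_bigcup. Qed.

HB.instance Definition _ :=
  @isMeasurable.Build (measure_tuple_display default_measure_display)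
    'cV[R]_n (g_sigma_preimage coord) cV_set0 cV_setC cV_bigcup.

Lemma measurable_coord (i : 'I_n) :
  measurable_fun [set: 'cV[R]_n] (fun u : 'cV[R]_n => u i ord0).
Proof.
move=> _ Y mY; rewrite setTI; apply: sub_sigma_algebra => /=.
rewrite -bigcup_seq/=; exists i => /=; first by rewrite mem_index_enum.
by exists Y => //; rewrite setTI.
Qed.

Lemma measurable_fun_coordP d (T : measurableType d) (f : T -> 'cV[R]_n) :
  measurable_fun [set: T] f <->
  forall i, measurable_fun [set: T] (fun t => f t i ord0).
Proof.
split=> [mf i|mf].
  exact: (measurableT_comp (measurable_coord i) mf).
suff : g_sigma_preimage (fun i => coord i \o f) `<=` measurable.
  by rewrite g_sigma_preimage_comp => fS _ A mA; apply: fS; exists A.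
apply: smallest_sub; first exact: sigma_algebra_measurable.
rewrite -bigcup_seq; apply: bigcup_sub => i _ A [B mB <-].
exact: mf.
Qed.

End measurable_cV.

Section lebesgue_cV.
Context {R : realType}.

Definition vcons n (p : measurableTypeR R * 'cV[R]_n) : 'cV[R]_n.+1 :=
  col_mx (const_mx p.1 : 'cV[R]_1) p.2.

Lemma vcons0 n (p : measurableTypeR R * 'cV[R]_n) :
  vcons p ord0 ord0 = p.1.
Proof.
transitivity ((const_mx p.1 : 'cV[R]_1) ord0 ord0); last by rewrite mxE.
rewrite -(col_mxEu (const_mx p.1 : 'cV[R]_1) p.2 ord0 ord0).
by congr (fun_of_matrix _ _ _); exact/val_inj.
Qed.

Lemma vconsS n (p : measurableTypeR R * 'cV[R]_n) (i : 'I_n) :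
  vcons p (lift ord0 i) ord0 = p.2 i ord0.
Proof.
rewrite -(col_mxEd (const_mx p.1 : 'cV[R]_1) p.2 i ord0).
by congr (fun_of_matrix _ _ _); exact/val_inj.
Qed.

Lemma measurable_vcons n :
  measurable_fun [set: measurableTypeR R * 'cV[R]_n] (@vcons n).
Proof.
apply/measurable_fun_coordP => i; case: (unliftP ord0 i) => [j ->|->].
  under eq_fun do rewrite vconsS.
  exact: (measurableT_comp (measurable_coord j) measurable_snd).
by under eq_fun do rewrite vcons0; exact: measurable_fst.
Qed.

Section step.
Variables (n : nat) (mu : {sigma_finite_measure set 'cV[R]_n -> \bar R}).

Definition lebesgue_step : set 'cV[R]_n.+1 -> \bar R :=
  pushforward (lebesgue_measure \x mu)%E (@vcons n).

Let step0 : lebesgue_step set0 = 0%E.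
Proof. by rewrite /lebesgue_step /pushforward preimage_set0 measure0. Qed.

Let step_ge0 A : (0 <= lebesgue_step A)%E.
Proof. exact: (measure_ge0 (lebesgue_measure \x mu)%E). Qed.

Let step_sigma_additive : semi_sigma_additive lebesgue_step.
Proof.
pose m : {measure set _ -> \bar R} := (lebesgue_measure \x mu)%E.
move=> F mF tF mUF; rewrite /lebesgue_step /pushforward preimage_bigcup.
apply: (@measure_semi_sigma_additive _ _ _ m).
- by move=> k; rewrite -[X in measurable X]setTI; exact: measurable_vcons.
- apply/trivIsetP => /= i j _ _ ij; rewrite -preimage_setI.
  by move/trivIsetP : tF => /(_ _ _ _ _ ij) ->//; rewrite preimage_set0.
- rewrite -preimage_bigcup -[X in measurable X]setTI.
  exact: measurable_vcons.
Qed.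

HB.instance Definition _ := isMeasure.Build _ _ _ lebesgue_step
  step0 step_ge0 step_sigma_additive.

Let step_sigma_finite : sigma_finite setT lebesgue_step.
Proof.
have /sigma_finiteP[F [TF ndF Foo]] :=
  @sigma_finiteT _ (measurableTypeR R) R lebesgue_measure.
have /sigma_finiteP[G [TG ndG Goo]] := sigma_finiteT mu.
pose h (u : 'cV[R]_n.+1) : measurableTypeR R * 'cV[R]_n :=
  (u ord0 ord0, \col_i u (lift ord0 i) ord0).
have hK : cancel (@vcons n) h.
  move=> [a u]; rewrite /h vcons0; congr pair.
  by apply/colP => i; rewrite mxE vconsS.
have mh : measurable_fun setT h.
  apply/measurable_fun_pairP; split; first exact: measurable_coord.
  apply/measurable_fun_coordP => i; rewrite /comp/=.
  by under eq_fun do rewrite mxE; exact: measurable_coord.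
exists (fun k => h @^-1` (F k `*` G k)).
  rewrite -preimage_bigcup (_ : \bigcup_k _ = setT) ?preimage_setT//.
  rewrite -setXTT TF TG predeqE => -[x y]; split.
    by move=> [k _ []/= ? ?]; split; exists k.
  move=> [/= [k _ Fkx] [l _ Gly]]; exists (maxn k l) => //; split.
    by move: x Fkx; exact/subsetPset/ndF/leq_maxl.
  by move: y Gly; exact/subsetPset/ndG/leq_maxr.
move=> k; have [mF Fk] := Foo k; have [mG Gk] := Goo k; split.
  by rewrite -[X in measurable X]setTI; apply: mh => //; exact: measurableX.
rewrite /lebesgue_step /pushforward -comp_preimage.
rewrite (_ : h \o _ = id); last by apply/funext => p /=; rewrite hK.
by rewrite preimage_id product_measure1E// lte_mul_pinfty// ge0_fin_numE.
Qed.

HB.instance Definition _ := @Measure_isSigmaFinite.Build _ _ _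
  lebesgue_step step_sigma_finite.

End step.

(* Lebesgue measure on R^n, as an iterated product along
   R^n.+1 = R * R^n; the volume of the one-point space R^0 is 1. *)
Fixpoint lebesgue_cV (n : nat) : {sigma_finite_measure set 'cV[R]_n -> \bar R} :=
  match n with
  | 0 => (\d_(0 : 'cV[R]_0))
  | k.+1 => lebesgue_step (lebesgue_cV k)
  end.

Lemma lebesgue_cV_box n (a b : 'cV[R]_n) : (forall i, a i ord0 <= b i ord0) ->
  lebesgue_cV n [set u | forall i, a i ord0 <= u i ord0 <= b i ord0] =
  (\prod_(i < n) (b i ord0 - a i ord0))%:E.
Proof.
elim: n a b => [|n IH] a b ab.
  by rewrite big_ord0 /= diracE mem_set//= => -[].
pose sub (u : 'cV[R]_n.+1) : 'cV[R]_n := \col_i u (lift ord0 i) ord0.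
pose B := [set u : 'cV[R]_n |
  forall i, sub a i ord0 <= u i ord0 <= sub b i ord0].
have mB : measurable B.
  rewrite (_ : B = \bigcap_(i in [set: 'I_n])
      (fun u : 'cV[R]_n => u i ord0) @^-1` `[sub a i ord0, sub b i ord0]).
    apply: fin_bigcap_measurable => // i _; rewrite -[X in measurable X]setTI.
    exact: measurable_coord.
  apply/seteqP; split=> u Bu i /=; first by rewrite in_itv/=.
  by have := Bu i I; rewrite /= in_itv.
rewrite /= /lebesgue_step /pushforward.
rewrite (_ : _ @^-1` _ = `[a ord0 ord0, b ord0 ord0]%classic `*` B).
  rewrite product_measure1E// (IH (sub a) (sub b)); last first.
    by move=> i; rewrite !mxE.
  rewrite big_ord_recl EFinM; congr (_ * _)%E.
    rewrite [LHS]lebesgue_measure_itv/= lte_fin lt_neqAle ab andbT EFinB.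
    by case: eqVneq => //= ->; rewrite subee.
  by congr EFin; apply: eq_bigr => i _; rewrite !mxE.
apply/seteqP; split=> [[x u]/= H|[x u]/= [xab Bu] i].
  split; first by have := H ord0; rewrite vcons0 in_itv.
  by move=> i; have := H (lift ord0 i); rewrite vconsS !mxE.
case: (unliftP ord0 i) => [j ->|->]; last by rewrite vcons0; rewrite in_itv in xab.
by have := Bu j; rewrite vconsS !mxE.
Qed.

End lebesgue_cV.

Section quadratic_forms.
Context {R : realType} {d : nat}.
Implicit Types (B M : 'M[R]_d) (u v z : 'cV[R]_d).

Definition dotv u v : R := (u^T *m v) ord0 ord0.

Definition qform B v : R := (v^T *m B *m v) ord0 ord0.

Definition posdefmx B := B^T = B /\ forall v, v != 0 -> 0 < qform B v.

Definition xi1 M z v : R := qform M v + dotv z v.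

End quadratic_forms.

Section probability.
Context {R : realType} {dT : measure_display} {T : measurableType dT}.
Variable P : probability T R.

Definition has_density n (U : {RV P >-> 'cV[R]_n}) (f : 'cV[R]_n -> R) :=
  [/\ measurable_fun [set: 'cV[R]_n] f, forall u, 0 <= f u &
      forall B, measurable B ->
        distribution P U B = (\int[lebesgue_cV n]_(u in B) (f u)%:E)%E].

(* Stationarity is taken in the weak (second-order) sense. *)
Definition centered_stationary (Y : R -> T -> R) (C0 : R -> R) :=
  [/\ forall t, Y t \in Lfun P 2%:E, forall t, ('E_P[Y t] = 0)%E &
      forall s t, covariance P (Y s) (Y t) = (C0 (s - t))%:E].

(* For sigma-algebras this is mutual independence, since each system contains
   the whole space. *)
Definition independent3 (F G H : set (set T)) :=
  forall A B D, F A -> G B -> H D ->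
    P (A `&` B `&` D) = (P A * P B * P D)%E.

(* Independence of the random variables V, U and the measurable process Y:
   there is a sub-sigma-algebra G with respect to which Y is jointly measurable
   and such that sigma(V), sigma(U), G are independent. For Y defined on a
   factor of a product space, G is the sigma-algebra of that factor; if Y is
   measurable for the Borel sets times sigma(Y_t, t real), take the latter.
   Joint measurability for the full sigma-algebra of T together with
   independence of sigma(Y_t, t real) from (V, U) would not control Y at a
   random time tau = h(V, U): when tau has no atoms, adding the indicator of
   {t = tau} to Y t preserves both properties (up to null sets) but changes
   Y at time tau. *)
Definition independent_with_process (V : {RV P >-> R}) n
    (U : {RV P >-> 'cV[R]_n}) (Y : R -> T -> R) :=
  exists G : set (set T),
    [/\ sigma_algebra [set: T] G, G `<=` measurable,
        measurable_fun [set: R * g_sigma_algebraType G]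
          (fun p : R * g_sigma_algebraType G => Y p.1 p.2) &
        independent3 (g_sigma_algebra_preimage V)
                     (g_sigma_algebra_preimage U) G].

Definition Zfield d (V : {RV P >-> R}) (U : {RV P >-> 'cV[R]_d})
    (Y : R -> T -> R) (f : 'cV[R]_d -> R) (S : 'cV[R]_d -> 'M[R]_d)
    (xi2 : 'cV[R]_d -> R) (g : R -> 'cV[R]_d -> R) (M : 'M[R]_d)
    (z : 'cV[R]_d) (x : 'cV[R]_d) (w : T) : R :=
  (2 * V w / pi) `^ (d%:R / 4) * (\det (S x)) `^ (1 / 4) *
  expR (- V w * qform (S x) (U w - x)) *
  Y (Num.sqrt (V w) * (xi1 M z (U w - x) + xi2 x)) w *
  (g (V w) x / Num.sqrt (f (U w))).

End probability.

Arguments has_density {R dT T} P {n} U f.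
Arguments independent_with_process {R dT T} P V {n} U Y.
Arguments Zfield {R dT T} P {d} V U Y f S xi2 g M z x w.

Section covariance_parameters.
Context {R : realType} {d : nat}.
Variables (S : 'cV[R]_d -> 'M[R]_d) (xi2 : 'cV[R]_d -> R).
Variables (M : 'M[R]_d) (z : 'cV[R]_d).
Implicit Types x y : 'cV[R]_d.

Definition cpar x y : R := - dotv z (x - y) + xi2 x - xi2 y.

Definition Apar x y : 'M[R]_d :=
  S x + S y + 4 *: (M *m (x - y) *m (x - y)^T *m M).

Definition mpar x y : R := qform M (x - y).

Definition Qpar x y : R :=
  cpar x y ^+ 2 - mpar x y ^+ 2 +
  qform ((S x + (2 * (mpar x y + cpar x y)) *: M) *m invmx (Apar x y) *m
         (S y + (2 * (mpar x y - cpar x y)) *: M)) (x - y).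

End covariance_parameters.

(* Main.v *)
Require Import Defs.
From HB Require Import structures.
From mathcomp Require Import all_boot all_order all_algebra.
From mathcomp Require Import ring lra.
From mathcomp Require Import all_classical all_reals all_analysis.
From mathcomp Require Import measurable_realfun.
Import Order.TTheory GRing.Theory Num.Theory.
Import numFieldNormedType.Exports.
Local Open Scope classical_set_scope.
Local Open Scope ring_scope.

(** Given (V, U), the product Z(x)Z(y) has mean a(x) a(y) exp (- (s - t)^2),
    where a(x), a(y) are the amplitudes and s, t the two (now deterministic)
    times at which Y is evaluated. The weight 1 / f(U) turns the average over U
    into a Lebesgue integral over R^d. Since the quadratic parts of xi1 (u - x)
    and xi1 (u - y) cancel, s - t is affine in u, so for fixed V the exponent is
    a quadratic polynomial in u; its quadratic part has matrix V A, its minimum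
    is V Q(x, y), and the resulting Gaussian integral gives the determinant
    factor. The case x = y, where Q = 0, shows that Z(x) is square integrable,
    which justifies the use of Fubini's theorem. *)

(** * Gaussian integrals on [R^n], by Schur complements *)

Section dotv.
Context {R : realType} {n : nat}.
Implicit Types (B : 'M[R]_n) (u v w : 'cV[R]_n).

Lemma dotvE u v : dotv u v = \sum_i u i ord0 * v i ord0.
Proof. by rewrite /dotv mxE; apply: eq_bigr => i _; rewrite mxE. Qed.

Lemma dotvC u v : dotv u v = dotv v u.
Proof. by rewrite !dotvE; apply: eq_bigr => i _; rewrite mulrC. Qed.

Lemma dotvDl u v w : dotv (u + v) w = dotv u w + dotv v w.
Proof. by rewrite /dotv linearD mulmxDl mxE. Qed.

Lemma dotvDr u v w : dotv w (u + v) = dotv w u + dotv w v.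
Proof. by rewrite /dotv mulmxDr mxE. Qed.

Lemma dotv0r u : dotv u 0 = 0.
Proof. by rewrite /dotv mulmx0 mxE. Qed.

Lemma dotvNl u w : dotv (- u) w = - dotv u w.
Proof. by rewrite /dotv linearN mulNmx mxE. Qed.

Lemma dotvNr u w : dotv w (- u) = - dotv w u.
Proof. by rewrite /dotv mulmxN mxE. Qed.

Lemma dotvZr (a : R) u w : dotv w (a *: u) = a * dotv w u.
Proof. by rewrite /dotv -scalemxAr mxE. Qed.

Lemma qformE B v : qform B v = dotv v (B *m v).
Proof. by rewrite /qform /dotv (mulmxA v^T). Qed.

Lemma dotv_mulmx B u v : dotv u (B *m v) = dotv (B^T *m u) v.
Proof. by rewrite /dotv trmx_mul trmxK (mulmxA u^T). Qed.

Lemma dotv_sym B u v : B^T = B -> dotv u (B *m v) = dotv v (B *m u).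
Proof. by move=> Bs; rewrite dotv_mulmx Bs dotvC. Qed.

Lemma dotv_outer u v w : (v *m w^T) *m u = dotv w u *: v.
Proof.
apply/colP => i; rewrite /dotv -mulmxA !mxE big_ord1.
by rewrite mulrC mxE.
Qed.

Lemma measurable_dotv (d : measure_display) (T : measurableType d)
    (h k : T -> 'cV[R]_n) :
  measurable_fun setT h -> measurable_fun setT k ->
  measurable_fun setT (fun t => dotv (h t) (k t)).
Proof.
move=> /measurable_fun_coordP mh /measurable_fun_coordP mk.
under eq_fun do rewrite dotvE.
by apply: measurable_sum => i; apply: measurable_funM.
Qed.

Lemma measurable_mulmx B (d : measure_display) (T : measurableType d)
    (h : T -> 'cV[R]_n) :
  measurable_fun setT h -> measurable_fun setT (fun t => B *m h t).
Proof.
move=> /measurable_fun_coordP mh; apply/measurable_fun_coordP => i.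
under eq_fun do rewrite mxE.
by apply: measurable_sum => j; apply: measurable_funM.
Qed.

Lemma measurable_qform B (d : measure_display) (T : measurableType d)
    (h : T -> 'cV[R]_n) :
  measurable_fun setT h -> measurable_fun setT (fun t => qform B (h t)).
Proof.
move=> mh; under eq_fun do rewrite qformE.
by apply: measurable_dotv => //; exact: measurable_mulmx.
Qed.

Lemma measurable_subv v (d : measure_display) (T : measurableType d)
    (h : T -> 'cV[R]_n) :
  measurable_fun setT h -> measurable_fun setT (fun t => h t - v).
Proof.
move=> /measurable_fun_coordP mh; apply/measurable_fun_coordP => i.
under eq_fun do rewrite !mxE.
by apply: measurable_funD.
Qed.

End dotv.

(** * Schur complement with respect to the first coordinate *)

Section schur.
Context {R : realType} {n : nat}.
Variable B : 'M[R]_(1 + n).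
Hypothesis Bpos : @posdefmx R n.+1 B.

(** The block splitting follows [vcons], that is R^(n+1) = R * R^n, along which [lebesgue_cV] is
    built; induction on the dimension can then handle the form and the measure together. *)
Definition schur_pivot : R := ulsubmx B ord0 ord0.
Definition schur_col : 'cV[R]_n := dlsubmx B.
Definition schur_compl : 'M[R]_n :=
  drsubmx B - schur_pivot^-1 *: (schur_col *m schur_col^T).

Local Notation a := schur_pivot.
Local Notation r := schur_col.

Lemma schur_block : B = block_mx a%:M r^T r (drsubmx B).
Proof.
rewrite -[LHS]submxK; congr block_mx.
  by rewrite [LHS]mx11_scalar.
have [Bs _] := Bpos.
by rewrite /r trmx_dlsub (_ : B^T = B).
Qed.

Lemma qform_block (t : R) (u : 'cV[R]_n) :
  @qform R n.+1 B (vcons (t, u)) =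
  a * t ^+ 2 + 2 * t * dotv r u + qform (drsubmx B) u.
Proof.
pose w : 'cV[R]_(1 + n) := col_mx t%:M u.
transitivity ((w^T *m block_mx a%:M r^T r (drsubmx B) *m w) ord0 ord0).
  rewrite -schur_block /qform (_ : vcons (t, u) = w)//.
  rewrite /w (_ : t%:M = const_mx t)//.
  by apply/matrixP => i j; rewrite !mxE !ord1.
rewrite /w tr_col_mx mul_row_block mul_row_col tr_scalar_mx.
rewrite mul_mx_scalar mulmxDl !mul_scalar_mx -scalemxAl !mxE.
have -> : \sum_j r^T ord0 j * u j ord0 = dotv r u by rewrite /dotv mxE.
have -> : \sum_j u^T ord0 j * r j ord0 = dotv r u by rewrite dotvC /dotv mxE.
rewrite [X in _ + (_ + X)](_ : _ = qform (drsubmx B) u); last first.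
  by rewrite /qform mxE.
rewrite eqxx mulr1n.
by ring.
Qed.

Lemma schur_pivot_gt0 : 0 < a.
Proof.
(* The pivot is the value of the form at the first basis vector. *)
have [_ /(_ (vcons (1, 0)))] := Bpos.
rewrite qform_block qformE mulmx0 !dotv0r.
rewrite expr1n mulr1 !mulr0 !addr0; apply.
apply/eqP => /colP/(_ ord0); rewrite vcons0 mxE => /eqP.
by rewrite oner_eq0.
Qed.

(** Completing the square in the first coordinate [t] alone: what remains depends only on [u] and is
    the form of the Schur complement. *)
Lemma qform_schur (t : R) (u : 'cV[R]_n) :
  @qform R n.+1 B (vcons (t, u)) =
  a * (t + a^-1 * dotv r u) ^+ 2 + qform schur_compl u.
Proof.
rewrite qform_block !qformE /schur_compl mulmxBl -scalemxAl dotv_outer.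
rewrite dotvDr dotvNr !dotvZr (dotvC u r).
by have := lt0r_neq0 schur_pivot_gt0; move: (dotv r u) => ru a0; field.
Qed.

Lemma schur_compl_posdef : posdefmx schur_compl.
Proof.
have [Bs Bp] := Bpos; split=> [|u u0].
  rewrite /schur_compl linearB/= linearZ/= trmx_mul trmxK trmx_drsub.
  by rewrite (_ : B^T = B).
(* This first coordinate makes the square in [qform_schur] vanish, so the form of [B] takes there
   the value of the Schur complement at [u]. *)
have := Bp (vcons (- (a^-1 * dotv r u), u)).
rewrite qform_schur addNr expr0n mulr0 add0r; apply.
apply: contra u0 => /eqP/colP u0; apply/eqP/colP => i.
by have := u0 (lift ord0 i); rewrite vconsS !mxE.
Qed.

(** One step of column elimination: right multiplication by a unipotent block matrix clears the
    upper right block and leaves a block lower triangular matrix. *)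
Lemma det_schur : \det B = a * \det schur_compl.
Proof.
have a0 := lt0r_neq0 schur_pivot_gt0.
have <- : \det (B *m block_mx 1%:M (- a^-1 *: r^T) 0 1%:M) = \det B.
  by rewrite det_mulmx det_ublock !det1 !mulr1.
rewrite {1}schur_block mulmx_block !mulmx1 !mulmx0 !addr0.
rewrite -scalemxAr mul_scalar_mx scalerA mulNr mulVf// scaleN1r addNr.
rewrite det_lblock det_scalar1; congr (_ * \det _).
by rewrite -scalemxAr /schur_compl scaleNr addrC.
Qed.

End schur.

Lemma posdefmx_det_gt0 (R : realType) n (B : 'M[R]_n) :
  posdefmx B -> 0 < \det B.
Proof.
elim: n => [|n IH] in B *; first by rewrite det_mx00.
move=> Bp; rewrite (det_schur _ Bp) mulr_gt0 ?(schur_pivot_gt0 _ Bp)//.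
exact: (IH _ (schur_compl_posdef _ Bp)).
Qed.

(** The integrand is the normal density of mean [m] and variance 1 / (2a), divided by its peak
    value. *)
Lemma integral_expR_sqr (R : realType) (a m : R) : 0 < a ->
  (\int[lebesgue_measure]_x (expR (- (a * (x - m) ^+ 2)))%:E =
   (Num.sqrt (pi / a))%:E)%E.
Proof.
move=> a0; pose s := Num.sqrt (2 * a)^-1.
have s2 : s ^+ 2 = (2 * a)^-1 by rewrite sqr_sqrtr// invr_ge0 ltW// mulr_gt0.
have s0 : s != 0 by rewrite gt_eqF// sqrtr_gt0 invr_gt0 mulr_gt0.
have pk : normal_peak s = (Num.sqrt (pi / a))^-1.
  by rewrite /normal_peak s2; congr (Num.sqrt _)^-1; field; rewrite gt_eqF.
have p0 : 0 < Num.sqrt (pi / a) by rewrite sqrtr_gt0 divr_gt0// pi_gt0.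
transitivity ((Num.sqrt (pi / a))%:E *
    \int[lebesgue_measure]_x (normal_pdf m s x)%:E)%E; last first.
  by rewrite integral_normal_pdf mule1.
rewrite -ge0_integralZl//.
- apply: eq_integral => x _; rewrite -EFinM /normal_pdf (negbTE s0) pk.
  rewrite mulVKf ?gt_eqF// /normal_fun s2; congr (expR _)%:E.
  by field; rewrite gt_eqF.
- by apply: measurableT_comp => //; exact: measurable_normal_pdf.
- by move=> x _; rewrite lee_fin normal_pdf_ge0.
Qed.

Lemma measurable_expR_qform (R : realType) n (B : 'M[R]_n) (b : 'cV[R]_n) :
  measurable_fun [set: 'cV[R]_n] (fun u => (expR (- qform B (u - b)))%:E).
Proof.
apply/measurable_EFinP/measurableT_comp => //; apply: measurableT_comp => //.
by apply: measurable_qform; exact: measurable_subv.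
Qed.

(** Induction on the dimension. By Tonelli the first coordinate is integrated first; [qform_schur]
    makes this a one-dimensional Gaussian integral whose value does not depend on the other
    coordinates, and the Schur complement remains. The determinants multiply by [det_schur]. *)
Lemma gaussian_integral (R : realType) n (B : 'M[R]_n) (b : 'cV[R]_n) :
  posdefmx B ->
  (\int[lebesgue_cV n]_u (expR (- qform B (u - b)))%:E =
   (Num.sqrt (pi ^+ n / \det B))%:E)%E.
Proof.
elim: n => [|n IH] in B b *.
  move=> _; rewrite /= integral_dirac//; last exact: measurable_expR_qform.
  rewrite diracE in_setT mul1e.
  rewrite det_mx00 expr0 divr1 sqrtr1 /qform mxE big1 ?oppr0 ?expR0//.
  by case.
move=> Bp; have ap := schur_pivot_gt0 _ Bp.
pose b0 := b ord0 ord0; pose b1 : 'cV[R]_n := \col_i b (lift ord0 i) ord0.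
have bE : b = vcons (b0, b1).
  apply/colP => i; case: (unliftP ord0 i) => [j|] ->.
    by rewrite vconsS mxE.
  by rewrite vcons0.
rewrite /= /lebesgue_step ge0_integral_pushforward//=; last 2 first.
- exact: measurable_vcons.
- exact: measurable_expR_qform.
rewrite preimage_setT fubini_tonelli2//=; last first.
  apply/measurable_EFinP/measurableT_comp => //; apply: measurableT_comp => //.
  by apply: measurable_qform; apply: measurable_subv; exact: measurable_vcons.
rewrite /fubini_G/=.
pose a := schur_pivot B.
transitivity (\int[lebesgue_cV n]_u ((Num.sqrt (pi / a))%:E *
  (expR (- qform (schur_compl B) (u - b1)))%:E))%E.
  apply: eq_integral => u _.
  (* For fixed [u], this is the centre in the first coordinate of the square given by [qform_schur]
     at the shifted point. *)
  rewrite -(@integral_expR_sqr _ _ (b0 - a^-1 * dotv (schur_col B) (u - b1)))//.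
  rewrite -ge0_integralZr//=; last first.
    apply/measurable_EFinP/measurableT_comp => //.
    apply: measurableT_comp => //; apply: measurable_funM => //.
    by apply: measurable_funX; exact: measurable_funB.
  apply: eq_integral => x _; rewrite -EFinM -expRD; congr (expR _)%:E.
  rewrite bE (_ : vcons (x, u) - _ = vcons (x - b0, u - b1)).
    rewrite qform_schur// -/a.
    ring.
  apply/colP => i; rewrite [LHS]mxE [X in _ + X]mxE.
  case: (unliftP ord0 i) => [j|] ->; first by rewrite !vconsS !mxE.
  by rewrite !vcons0.
rewrite ge0_integralZl//=; last exact: measurable_expR_qform.
rewrite (IH _ _ (schur_compl_posdef _ Bp)) -EFinM -sqrtrM; last first.
  by rewrite divr_ge0 ?pi_ge0// ltW.
rewrite (det_schur _ Bp) -/a; congr (Num.sqrt _)%:E.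
by rewrite exprS invfM; ring.
Qed.

(** * Independence and Fubini *)

(** Measurable rectangles are stable under intersection and generate the product sigma-algebra, so
    they determine a finite measure. *)
Lemma eq_measure_rectangle d1 d2 (T1 : measurableType d1)
    (T2 : measurableType d2) (R : realType)
    (m1 m2 : {measure set (T1 * T2) -> \bar R}) :
  (m1 setT < +oo)%E ->
  (forall A B, measurable A -> measurable B -> m1 (A `*` B) = m2 (A `*` B)) ->
  forall X, measurable X -> m1 X = m2 X.
Proof.
move=> m1oo m12 X mX.
pose C : set (set (T1 * T2)) :=
  [set C | exists A, measurable A /\ exists B, measurable B /\ C = A `*` B].
apply: (measure_unique C (fun=> setT)) => //.
- rewrite measurable_prod_measurableType //; congr (<<s _ >>).
  rewrite predeqE; split => [[A mA [B mB <-]]|[A [mA [B [mB ->]]]]].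
    by exists A; split => //; exists B.
  by exists A => //; exists B.
- move=> /= _ _ [X1 [mX1 [X2 [mX2 ->]]]] [Y1 [mY1 [Y2 [mY2 ->]]]].
  rewrite -setXI; exists (X1 `&` Y1); split; first exact: measurableI.
  by exists (X2 `&` Y2); split => //; exact: measurableI.
- by move=> _; exists setT; split => //; exists setT; rewrite setXTT.
- by rewrite bigcup_const//; exists 0%N.
- by move=> _ [A [mA [B [mB ->]]]]; exact: m12.
Qed.

Section independent_pair.
Local Open Scope ereal_scope.
Context dT d1 d2 (T : measurableType dT) (T1 : measurableType d1)
  (T2 : measurableType d2) (R : realType) (P : probability T R).
Variables (X : {mfun T >-> T1}) (Y : {mfun T >-> T2}).
Hypothesis XY : forall A B, measurable A -> measurable B ->
  P (X @^-1` A `&` Y @^-1` B) = P (X @^-1` A) * P (Y @^-1` B).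

Let mXY : measurable_fun setT (fun w => (X w, Y w)).
Proof. by apply: measurable_fun_pair. Qed.

Let W : {mfun T >-> (T1 * T2)%type} :=
  HB.pack (fun w => (X w, Y w)) (isMeasurableFun.Build _ _ _ _ _ mXY).

Let distribution_pair (A : set (T1 * T2)) : measurable A ->
  (distribution P X \x distribution P Y) A = distribution P W A.
Proof.
apply: product_measure_unique => B C mB mC.
by rewrite /distribution/= /pushforward -XY.
Qed.

(** By independence the joint law of (X, Y) is the product of the two laws; Tonelli applies to the
    product, and both integrals are then carried back to [P]. *)
Lemma ge0_integral_independent (h : T1 * T2 -> \bar R) :
  measurable_fun setT h -> (forall p, 0 <= h p) ->
  \int[P]_w h (X w, Y w) = \int[P]_w \int[P]_w' h (X w, Y w').
Proof.
move=> mh h0.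
rewrite -(@ge0_integral_distribution _ _ _ _ _ P W h)//.
transitivity (\int[distribution P X \x distribution P Y]_p h p).
  by apply: eq_measure_integral => A mA _; exact/esym/distribution_pair.
rewrite fubini_tonelli1//.
rewrite ge0_integral_distribution//; last 2 first.
- exact: measurable_fun_fubini_tonelli_F.
- by move=> x; apply: integral_ge0.
apply: eq_integral => w _.
rewrite /fubini_F /=.
rewrite -(@ge0_integral_distribution _ _ _ _ _ P Y (fun y => h (X w, y)))//.
exact: measurableT_comp.
Qed.

(** The signed version, by Fubini. Integrability of the sections is asked at every [w], since each
    inner integral is carried back to [P] separately. *)
Lemma integral_independent (h : T1 * T2 -> \bar R) :
  measurable_fun setT h ->
  P.-integrable setT (fun w => h (X w, Y w)) ->
  (forall w, P.-integrable setT (fun w' => h (X w, Y w'))) ->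
  \int[P]_w h (X w, Y w) = \int[P]_w \int[P]_w' h (X w, Y w').
Proof.
move=> mh ih ihw.
have eqm A : measurable A -> A `<=` setT ->
    (distribution P X \x distribution P Y) A = distribution P W A.
  by move=> mA _; exact: distribution_pair.
have ihp : (distribution P X \x distribution P Y).-integrable setT h.
  apply/integrableP; split=> //; rewrite (eq_measure_integral _ eqm).
  rewrite ge0_integral_distribution//; last exact: measurableT_comp.
  by have /integrableP[_] := ih.
rewrite -(@integral_distribution _ _ _ _ _ P W h)//.
rewrite -(eq_measure_integral _ eqm) -integral12_prod_meas1//.
rewrite integral_distribution//; last 2 first.
- by have /integrableP[] := integrable_fubini_F ihp.
- have /integrableP[mF Foo] := integrable_fubini_F ihp.
  apply/integrableP; split; first exact: measurableT_comp.
  apply: le_lt_trans Foo; rewrite ge0_integral_distribution//.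
  exact: measurableT_comp.
apply: eq_integral => w _.
rewrite /fubini_F /=.
rewrite (@integral_distribution _ _ _ _ _ P Y (fun y => h (X w, y)))//.
  exact: measurableT_comp.
exact: ihw.
Qed.

End independent_pair.

Section independent3.
Local Open Scope ereal_scope.
Context dT d1 d2 (T : measurableType dT) (T1 : measurableType d1)
  (T2 : measurableType d2) (R : realType) (P : probability T R).
Variables (V : {mfun T >-> T1}) (U : {mfun T >-> T2}) (G : set (set T)).
Hypotheses (Gm : G `<=` measurable)
  (VUG : independent3 P (g_sigma_algebra_preimage V)
                        (g_sigma_algebra_preimage U) G).

Let mVU : measurable_fun setT (fun w => (V w, U w)).
Proof. by apply: measurable_fun_pair. Qed.

Definition pair_mfun : {mfun T >-> (T1 * T2)%type} :=
  HB.pack (fun w => (V w, U w)) (isMeasurableFun.Build _ _ _ _ _ mVU).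

Lemma independent3_rectangle A B D : measurable A -> measurable B -> G D ->
  P (V @^-1` A `&` U @^-1` B `&` D) = P (V @^-1` A) * P (U @^-1` B) * P D.
Proof.
move=> mA mB GD; apply: VUG => //.
  by exists A => //; rewrite setTI.
by exists B => //; rewrite setTI.
Qed.

Hypothesis GT : G setT.

Lemma independent3_pair12 A B : measurable A -> measurable B ->
  P (V @^-1` A `&` U @^-1` B) = P (V @^-1` A) * P (U @^-1` B).
Proof.
move=> mA mB; rewrite -[LHS]/(P _) -[X in P X]setIT independent3_rectangle//.
by rewrite probability_setT mule1.
Qed.

(** With [D] fixed, both sides are finite measures in [C]: the image under (V, U) of [P] restricted
    to [D], and the law of (V, U) scaled by [P D]. They agree on rectangles by independence of the
    three. *)
Lemma independent3_pair C D : measurable C -> G D ->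
  P (pair_mfun @^-1` C `&` D) = P (pair_mfun @^-1` C) * P D.
Proof.
move=> mC GD; have mD := Gm _ GD.
have PD0 : (0 <= fine (P D))%R by rewrite fine_ge0.
pose mpush : {measure set (T1 * T2) -> \bar R} :=
  pushforward (mrestr P mD) pair_mfun.
pose m1 := mpush mVU.
pose m2 : {measure set (T1 * T2) -> \bar R} :=
  mscale (NngNum PD0) (distribution P pair_mfun).
suff -> : P (pair_mfun @^-1` C `&` D) = m2 C.
  by rewrite /m2 /= /mscale/= fineK ?fin_num_measure// muleC.
rewrite -[LHS]/(m1 C); apply: eq_measure_rectangle => //.
  rewrite /m1 /= /pushforward /mrestr preimage_setT setTI.
  by rewrite ltey_eq fin_num_measure.
move=> A B mA mB; rewrite /m1 /m2 /= /pushforward /mrestr /mscale/=.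
rewrite /distribution/= /pushforward/= fineK ?fin_num_measure//.
rewrite -[X in P (X `&` _)]/(V @^-1` A `&` U @^-1` B).
rewrite -[X in _ = _ * P X]/(V @^-1` A `&` U @^-1` B).
by rewrite independent3_rectangle// independent3_pair12// muleC.
Qed.

End independent3.

(** * Moments of the process at an independent random time *)

Section random_time.
Local Open Scope ereal_scope.
Context dT d1 (T : measurableType dT) (T1 : measurableType d1)
  (R : realType) (P : probability T R).
Variables (X : {mfun T >-> T1}) (G : set (set T)).
Hypotheses (sG : sigma_algebra setT G) (Gm : G `<=` measurable).
Hypothesis XG : forall A D, measurable A -> G D ->
  P (X @^-1` A `&` D) = P (X @^-1` A) * P D.
Variables (Y : R -> T -> R) (C0 : R -> R).
Hypothesis mY : measurable_fun [set: R * g_sigma_algebraType G]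
  (fun p : R * g_sigma_algebraType G => Y p.1 p.2).
Hypothesis Ystat : centered_stationary P Y C0.

Let TG := g_sigma_algebraType G.

(* Seen as a random element of (T, G), the sample point [w] is independent of
   [X], and [Y t w] is a jointly measurable function of [t] and [w]. *)
Let idG (w : T) : TG := w.

Let midG : measurable_fun setT idG.
Proof.
move=> _ B mB; rewrite setTI preimage_id; apply: Gm.
by move: mB; rewrite /measurable/= (sigma_algebra_id sG).
Qed.

Let iG : {mfun T >-> TG} :=
  HB.pack idG (isMeasurableFun.Build _ _ _ _ _ midG).

Let indep A B : measurable A -> measurable B ->
  P (X @^-1` A `&` iG @^-1` B) = P (X @^-1` A) * P (iG @^-1` B).
Proof.
move=> mA mB; apply: XG => //.
by move: mB; rewrite /measurable/= (sigma_algebra_id sG).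
Qed.

Variables (a s t : T1 -> R).
Hypotheses (ma : measurable_fun setT a) (ms : measurable_fun setT s)
  (mt : measurable_fun setT t).

Let mYX (r : T1 -> R) : measurable_fun setT r ->
  measurable_fun [set: T1 * TG] (fun p : T1 * TG => Y (r p.1) p.2).
Proof.
move=> mr.
apply: (@measurableT_comp _ _ _ _ _ _ (fun p : R * TG => Y p.1 p.2) _
  (fun p : T1 * TG => (r p.1, p.2)) mY).
apply: measurable_fun_pair => //=.
exact: (measurableT_comp mr measurable_fst).
Qed.

Lemma measurable_random_time :
  measurable_fun setT (fun w => Y (s (X w)) w).
Proof.
apply: (@measurableT_comp _ _ _ _ _ _ (fun p : T1 * TG => Y (s p.1) p.2)
  _ (fun w : T => (X w, iG w)) (mYX _ ms)).
exact: measurable_fun_pair.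
Qed.

Lemma process_moment2 (r q : R) :
  P.-integrable setT (fun w => (Y r w * Y q w)%:E) /\
  \int[P]_w (Y r w * Y q w)%:E = (C0 (r - q))%:E.
Proof.
have [Y2 Y0 Ycov] := Ystat.
have YY := Lfun2_mul_Lfun1 (Y2 r) (Y2 q).
split; first by apply/Lfun1_integrable.
rewrite -Ycov covarianceE.
- by rewrite !Y0 mule0 sube0 unlock.
- by rewrite Lfun_subset12 ?fin_num_measure.
- by rewrite Lfun_subset12 ?fin_num_measure.
- exact: YY.
Qed.

(** With [X] frozen, the time is deterministic and [Y] has mean zero there. *)
Lemma random_time_moment1 :
  P.-integrable setT (fun w => (a (X w) * Y (s (X w)) w)%:E) ->
  \int[P]_w (a (X w) * Y (s (X w)) w)%:E = 0.
Proof.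
move=> iaY; have [Y2 Y0 _] := Ystat.
have iY r : P.-integrable setT (fun w => (Y r w)%:E).
  by apply/Lfun1_integrable; rewrite Lfun_subset12 ?fin_num_measure.
rewrite (@integral_independent _ _ _ _ _ _ _ _ X iG indep
  (fun p => (a p.1 * Y (s p.1) p.2)%:E))//=.
- rewrite integral0_eq// => w _.
  under eq_integral do rewrite EFinM.
  have := Y0 (s (X w)); rewrite unlock => EY0.
  by rewrite integralZl// EY0 mule0.
- apply/measurable_EFinP/measurable_funM; last exact: mYX.
  exact: (measurableT_comp ma measurable_fst).
- move=> w; under eq_fun do rewrite EFinM.
  exact: integrableZl.
Qed.

Let mh : measurable_fun [set: T1 * TG]
  (fun p => (a p.1 * (Y (s p.1) p.2 * Y (t p.1) p.2))%:E).
Proof.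
apply/measurable_EFinP/measurable_funM.
  exact: (measurableT_comp ma measurable_fst).
by apply: measurable_funM; exact: mYX.
Qed.

Lemma random_time_moment2 :
  P.-integrable setT
    (fun w => (a (X w) * (Y (s (X w)) w * Y (t (X w)) w))%:E) ->
  \int[P]_w (a (X w) * (Y (s (X w)) w * Y (t (X w)) w))%:E =
  \int[P]_w (a (X w) * C0 (s (X w) - t (X w)))%:E.
Proof.
move=> iaY.
rewrite (@integral_independent _ _ _ _ _ _ _ _ X iG indep
  (fun p => (a p.1 * (Y (s p.1) p.2 * Y (t p.1) p.2))%:E))//=.
- apply: eq_integral => w _; under eq_integral do rewrite EFinM.
  have [iYY eYY] := process_moment2 (s (X w)) (t (X w)).
  by rewrite integralZl// eYY.
- move=> w; under eq_fun do rewrite EFinM.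
  by apply: integrableZl => //; have [] := process_moment2 (s (X w)) (t (X w)).
Qed.

(** At equal times the integrand is nonnegative, so Tonelli replaces Fubini and no integrability is
    assumed. This version serves to prove that Z(x) is square integrable. *)
Lemma ge0_random_time_moment2 : (forall p, (0 <= a p)%R) -> s = t ->
  \int[P]_w (a (X w) * (Y (s (X w)) w * Y (t (X w)) w))%:E =
  \int[P]_w (a (X w) * C0 (s (X w) - t (X w)))%:E.
Proof.
move=> a0 st.
rewrite (@ge0_integral_independent _ _ _ _ _ _ _ _ X iG indep
  (fun p => (a p.1 * (Y (s p.1) p.2 * Y (t p.1) p.2))%:E))//=.
- apply: eq_integral => w _; under eq_integral do rewrite EFinM.
  have [iYY eYY] := process_moment2 (s (X w)) (t (X w)).
  by rewrite integralZl// eYY.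
- by move=> p; rewrite lee_fin mulr_ge0// st -expr2 sqr_ge0.
Qed.

End random_time.

(** * Integration against a measure given by a density *)

Section density.
Local Open Scope ereal_scope.
Context d (T : measurableType d) (R : realType).
Variables (mu nu : {measure set T -> \bar R}) (f : T -> R).
Hypotheses (mf : measurable_fun setT f) (f0 : forall x, (0 <= f x)%R).
Hypothesis nuE : forall A, measurable A -> nu A = \int[mu]_(x in A) (f x)%:E.

Import HBNNSimple.

Let integral_density_indic (A : set T) : measurable A ->
  \int[nu]_x (\1_A x)%:E = \int[mu]_x ((\1_A x)%:E * (f x)%:E).
Proof.
move=> mA; rewrite integral_indic// setIT nuE// integral_mkcond.
apply: eq_integral => x _; rewrite patchE indicE.
by case: ifPn => _; rewrite ?mul1e ?mul0e.
Qed.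

Let integral_density_nnsfun (h : {nnsfun T >-> R}) :
  \int[nu]_x (h x)%:E = \int[mu]_x ((h x)%:E * (f x)%:E).
Proof.
under [LHS]eq_integral do rewrite fimfunE -fsumEFin//.
rewrite [LHS]ge0_integral_fsum//; last 2 first.
- by move=> r; exact/measurable_EFinP/measurableT_comp.
- by move=> n x _; rewrite EFinM nnfun_muleindic_ge0.
under [RHS]eq_integral.
  move=> x xD; rewrite fimfunE -fsumEFin// muleC ge0_mule_fsumr; last first.
    by move=> r; rewrite EFinM nnfun_muleindic_ge0.
  over.
rewrite [RHS]ge0_integral_fsum//; last 2 first.
- move=> r; apply: emeasurable_funM; first exact/measurable_EFinP.
  by apply/measurable_EFinP/measurableT_comp.
- move=> n x _; rewrite mule_ge0//; first by rewrite lee_fin.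
  by rewrite EFinM nnfun_muleindic_ge0.
apply: eq_fsbigr => r _.
(* A nonnegative simple function has empty level sets at negative [r], so both terms vanish;
   otherwise [r] can be pulled out of the integrals. *)
have [r0|r0] := ltP r 0%R.
  rewrite preimage_nnfun0// !integral0_eq// => x _.
    by rewrite indic0/= mulr0 ?mule0.
  by rewrite indic0/= mulr0 ?mule0.
under eq_integral do rewrite EFinM.
under [RHS]eq_integral do rewrite EFinM muleCA (muleC (f _)%:E).
rewrite !ge0_integralZl//.
- by rewrite integral_density_indic.
- apply: emeasurable_funM; last exact/measurable_EFinP.
  exact/measurable_EFinP.
- by move=> x _; rewrite mule_ge0// lee_fin.
exact/measurable_EFinP.
Qed.

(** From indicators to simple functions by linearity, then to [h] by monotone convergence on both
    sides. *)
Lemma ge0_integral_density (h : T -> \bar R) :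
  measurable_fun setT h -> (forall x, 0 <= h x) ->
  \int[nu]_x h x = \int[mu]_x (h x * (f x)%:E).
Proof.
move=> mh h0; pose h_ := nnsfun_approx measurableT mh.
transitivity (limn (fun n => \int[nu]_x (h_ n x)%:E)).
  rewrite -monotone_convergence//=.
  - apply: eq_integral => ? /[!inE] xD; apply/esym/cvg_lim => //=.
    exact: cvg_nnsfun_approx.
  - by move=> n; exact/measurable_EFinP/measurable_funTS.
  - by move=> n ? _; rewrite lee_fin.
  - by move=> ? _ ? ? mn; rewrite lee_fin; exact/lefP/nd_nnsfun_approx.
transitivity (limn (fun n => \int[mu]_x ((h_ n x)%:E * (f x)%:E))).
  by apply: congr_lim; apply/funext => n; exact: integral_density_nnsfun.
rewrite -monotone_convergence//=.
- apply: eq_integral => x /[!inE] xD; apply/cvg_lim => //.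
  by apply: cvgeZr => //; exact: cvg_nnsfun_approx.
- move=> n; apply: emeasurable_funM; exact/measurable_EFinP.
- by move=> n x _; rewrite mule_ge0// lee_fin.
- move=> x _ m n mn; rewrite lee_wpmul2r// lee_fin//.
  exact/lefP/nd_nnsfun_approx.
Qed.

End density.

(** * Completing the square *)

Section posdef.
Context {R : realType} {n : nat}.
Implicit Types (B : 'M[R]_n) (v : 'cV[R]_n).

Lemma qformD B B' v : qform (B + B') v = qform B v + qform B' v.
Proof. by rewrite !qformE mulmxDl dotvDr. Qed.

Lemma qformZ (a : R) B v : qform (a *: B) v = a * qform B v.
Proof. by rewrite !qformE -scalemxAl dotvZr. Qed.

Lemma qform_outer (b v : 'cV[R]_n) : qform (b *m b^T) v = dotv v b ^+ 2.
Proof. by rewrite qformE dotv_outer dotvZr (dotvC b). Qed.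

Lemma qform_subr B (v w : 'cV[R]_n) : B^T = B ->
  qform B (v - w) = qform B v - 2 * dotv v (B *m w) + qform B w.
Proof.
move=> Bs; rewrite !qformE mulmxBr !dotvDl !dotvDr !dotvNl !dotvNr.
by rewrite (dotv_sym B w v)//; ring.
Qed.

Lemma posdefmx_ge0 B v : posdefmx B -> 0 <= qform B v.
Proof.
move=> [_ Bp]; have [->|/Bp/ltW//] := eqVneq v 0.
by rewrite qformE mulmx0 dotv0r.
Qed.

Lemma posdefmxZ (a : R) B : 0 < a -> posdefmx B -> posdefmx (a *: B).
Proof.
move=> a0 [Bs Bp]; split; first by rewrite linearZ/= Bs.
by move=> v /Bp Bv; rewrite qformZ mulr_gt0.
Qed.

Lemma posdefmxD B B' : posdefmx B -> posdefmx B' -> posdefmx (B + B').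
Proof.
move=> [Bs Bp] B'p; split; first by rewrite linearD/= Bs B'p.1.
by move=> v /Bp Bv; rewrite qformD ltr_wpDr// posdefmx_ge0.
Qed.

End posdef.

Section complete_square.
Context {R : realType} {d : nat}.
Variables (S : 'cV[R]_d -> 'M[R]_d) (xi2 : 'cV[R]_d -> R).
Variables (M : 'M[R]_d) (z : 'cV[R]_d).
Hypotheses (Spos : forall x, posdefmx (S x)) (Msym : M^T = M).
Implicit Types x y u : 'cV[R]_d.

Lemma AparE x y :
  Apar S M x y = S x + S y + 4 *: ((M *m (x - y)) *m (M *m (x - y))^T).
Proof. by rewrite /Apar trmx_mul Msym !mulmxA. Qed.

(** The term added to the positive definite S x + S y is four times the outer square of M (x - y),
    whose form is nonnegative. *)
Lemma Apar_posdef x y : posdefmx (Apar S M x y).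
Proof.
have [Ss Sp] := posdefmxD _ _ (Spos x) (Spos y).
rewrite AparE; split=> [|v /Sp Sv].
  by rewrite linearD/= Ss linearZ/= trmx_mul trmxK.
by rewrite qformD qformZ qform_outer ltr_wpDr// mulr_ge0// sqr_ge0.
Qed.

(** Seen as a polynomial in w = u - y, the exponent to be minimized has linear part -2 w^T b with b
    = [bpar x y]. Its minimizer is therefore A^-1 b, which gives [gauss_center]. *)
Definition bpar x y : 'cV[R]_d :=
  (S x + (2 * (mpar M x y + cpar xi2 z x y)) *: M) *m (x - y).

Definition gauss_center x y : 'cV[R]_d :=
  y + invmx (Apar S M x y) *m bpar x y.

(** With h = x - y, the rank-one term of A sends h to 4 m M h, and 4 m = 2 (m + c) + 2 (m - c). This
    explains the second factor in the formula for Q. *)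
Lemma Apar_sub x y : Apar S M x y *m (x - y) - bpar x y =
  (S y + (2 * (mpar M x y - cpar xi2 z x y)) *: M) *m (x - y).
Proof.
rewrite AparE /bpar /mpar qformE; set h := x - y.
rewrite !mulmxDl -!scalemxAl dotv_outer dotvC.
set m := dotv h _; set c := cpar _ _ _ _.
apply/colP => i; rewrite !mxE; ring.
Qed.

Lemma complete_square x y u :
  qform (S x) (u - x) + qform (S y) (u - y) +
    ((xi1 M z (u - x) + xi2 x) - (xi1 M z (u - y) + xi2 y)) ^+ 2 =
  qform (Apar S M x y) (u - gauss_center x y) + Qpar S xi2 M z x y.
Proof.
have [As _] := Apar_posdef x y.
have Au : Apar S M x y \in unitmx.
  by rewrite unitmxE unitfE gt_eqF// posdefmx_det_gt0//; exact: Apar_posdef.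
(* By [Apar_sub] the right factor of Q applied to h is A h - b; the left factor is symmetric and
   turns h into b, so the quadratic term of Q is b^T h - b^T A^-1 b. *)
have QE : Qpar S xi2 M z x y = cpar xi2 z x y ^+ 2 - mpar M x y ^+ 2 +
    dotv (bpar x y) (x - y) -
    dotv (bpar x y) (invmx (Apar S M x y) *m bpar x y).
  rewrite /Qpar qformE -!mulmxA -Apar_sub dotv_mulmx.
  have -> (k : R) : (S x + k *: M)^T = S x + k *: M.
    by rewrite linearD/= linearZ/= Msym (Spos x).1.
  rewrite -/(bpar x y) mulmxBr mulKmx// !dotvDr !dotvNr; ring.
rewrite QE /gauss_center; set q := invmx _ *m _.
have Aq : Apar S M x y *m q = bpar x y by rewrite mulKVmx.
pose h := x - y; pose w := u - y.
have -> : u - x = w - h by rewrite /w /h opprB addrA subrK.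
have -> : u - (y + q) = w - q by rewrite opprD addrA.
have db v : dotv v (bpar x y) = dotv v (S x *m h) +
    2 * (mpar M x y + cpar xi2 z x y) * dotv v (M *m h).
  by rewrite /bpar mulmxDl dotvDr -scalemxAl dotvZr.
rewrite [in RHS]qform_subr// Aq (qformE (Apar _ _ _ _) q) Aq.
rewrite AparE !qformD qformZ qform_outer (dotvC (bpar x y) h).
rewrite (dotvC (bpar x y) q) !db /cpar /mpar -/h -/w /xi1.
clearbody w h; have := (Spos x).1; have := (Spos y).1 => Sys Sxs.
rewrite !qform_subr// dotvDr dotvNr (qformE (S x) h) !(qformE M h).
by ring.
Qed.

End complete_square.

(** * The covariance kernel *)

Lemma integrable_sqr_Lfun2 d (T : measurableType d) (R : realType)
    (mu : {measure set T -> \bar R}) (h : T -> R) :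
  measurable_fun setT h -> (\int[mu]_x (h x ^+ 2)%:E < +oo)%E ->
  h \in Lfun mu 2%:E.
Proof.
move=> mh hoo; rewrite inE; apply/andP; split; rewrite inE//=.
rewrite /finite_norm unlock /=.
rewrite poweR_lty//; apply: le_lt_trans hoo.
by under [leLHS]eq_integral do
  rewrite powR_mulrn ?normr_ge0// real_normK ?num_real//.
Qed.

Lemma measurable_invsqrt d (T : measurableType d) (R : realType) (h : T -> R) :
  measurable_fun setT h -> (forall t, 0 < h t) ->
  measurable_fun setT (fun t => (Num.sqrt (h t))^-1).
Proof.
move=> mh h0.
rewrite (_ : (fun t => _) = (fun t => (h t) `^ (- 2^-1))).
  exact: (measurableT_comp (measurable_powR _) mh).
by apply/funext => t; rewrite powRN powR12_sqrt ?ltW.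
Qed.

Lemma measurable_sqrt (R : realType) :
  measurable_fun [set: R] (Num.sqrt : R -> R).
Proof. apply: continuous_measurable_fun; exact: sqrt_continuous. Qed.

(** Once all factors are put under one square root, the powers of [v] and of pi cancel: this is the
    purpose of the normalization (2V/pi)^(d/4) in Z. *)
Lemma gaussian_constant (R : realType) (d : nat) (v D : R) :
  0 < v -> 0 < D ->
  (2 * v / pi) `^ (d%:R / 2) * Num.sqrt (pi ^+ d / (v ^+ d * D)) =
  2 `^ (d%:R / 2) / Num.sqrt D.
Proof.
move=> v0 D0; have p0 := pi_gt0 R.
have K (k : R) : 0 <= k -> k `^ (d%:R / 2) = Num.sqrt (k ^+ d).
  by move=> k0; rewrite powRrM powR_mulrn// powR12_sqrt ?exprn_ge0.
rewrite !K ?ler0n//; last by rewrite divr_ge0 ?mulr_ge0 ?ltW.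
rewrite -sqrtrV ?ltW// -!sqrtrM ?exprn_ge0//; last first.
  by rewrite divr_ge0 ?mulr_ge0 ?ltW.
congr Num.sqrt; rewrite !exprMn exprVn; field.
by rewrite !expf_neq0 ?gt_eqF.
Qed.

Section covariance_kernel.
Context {R : realType} {dT : measure_display} {T : measurableType dT}.
Context {P : probability T R} {d : nat}.
Variables (V : {RV P >-> R}) (U : {RV P >-> 'cV[R]_d}) (f : 'cV[R]_d -> R).
Hypotheses (V_gt0 : forall w, 0 < V w) (f_gt0 : forall u, 0 < f u).
Hypothesis Uf : has_density P U f.
Variables (S : 'cV[R]_d -> 'M[R]_d) (xi2 : 'cV[R]_d -> R).
Variables (M : 'M[R]_d) (z : 'cV[R]_d) (g : R -> 'cV[R]_d -> R).
Hypotheses (Spos : forall x, posdefmx (S x)) (Msym : M^T = M).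
Hypothesis g_gt0 : forall (v : R) x, 0 < v -> 0 < g v x.
Hypothesis g_meas :
  forall x, measurable_fun (`]0, +oo[ : set R) (fun v => g v x).
Hypothesis VU : forall A B, measurable A -> measurable B ->
  P (V @^-1` A `&` U @^-1` B) = (P (V @^-1` A) * P (U @^-1` B))%E.
Implicit Types (x y : 'cV[R]_d) (p : measurableTypeR R * 'cV[R]_d).

(* [g] is only assumed measurable on ]0, +oo[, where [V] takes its values. *)
Definition gpos x : R -> R := (fun v => g v x) \_ `]0, +oo[.

Lemma gposE x v : 0 < v -> gpos x v = g v x.
Proof. by move=> v0; rewrite /gpos patchE mem_set//= in_itv/= v0. Qed.

Lemma gpos_ge0 x v : 0 <= gpos x v.
Proof.
rewrite /gpos patchE; case: ifPn => //.
by rewrite inE/= in_itv/= andbT => /g_gt0/ltW.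
Qed.

Lemma measurable_gpos x : measurable_fun setT (gpos x).
Proof. by apply/(measurable_restrictT _ _).1 => //. Qed.

Definition amplitude x p : R :=
  (2 * p.1 / pi) `^ (d%:R / 4) * (\det (S x)) `^ (1 / 4) *
  expR (- p.1 * qform (S x) (p.2 - x)) * (gpos x p.1 / Num.sqrt (f p.2)).

Definition sample_time x p : R := Num.sqrt p.1 * (xi1 M z (p.2 - x) + xi2 x).

Lemma amplitude_ge0 x p : 0 <= amplitude x p.
Proof.
by rewrite /amplitude !mulr_ge0 ?powR_ge0 ?expR_ge0 ?invr_ge0 ?sqrtr_ge0
  ?gpos_ge0.
Qed.

Lemma measurable_amplitude x : measurable_fun setT (amplitude x).
Proof.
have m1 : measurable_fun setT
  (fst : measurableTypeR R * 'cV[R]_d -> measurableTypeR R) := measurable_fst.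
have m2 : measurable_fun setT
  (snd : measurableTypeR R * 'cV[R]_d -> 'cV[R]_d) := measurable_snd.
have [mf _ _] := Uf.
apply: measurable_funM; first apply: measurable_funM; last 1 first.
- apply: measurable_funM.
    exact: (measurableT_comp (measurable_gpos x) m1).
  by apply: measurable_invsqrt => //; exact: (measurableT_comp mf m2).
- apply: measurable_funM => //.
  apply: (measurableT_comp (measurable_powR _)).
  by apply: measurable_funM => //; exact: measurable_funM.
- apply: measurableT_comp => //; apply: measurable_funM.
    exact: measurableT_comp.
  by apply: measurable_qform; exact: measurable_subv.
Qed.

Lemma measurable_sample_time x : measurable_fun setT (sample_time x).
Proof.
have m1 : measurable_fun setT
  (fst : measurableTypeR R * 'cV[R]_d -> measurableTypeR R) := measurable_fst.
have m2 : measurable_fun setT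
  (snd : measurableTypeR R * 'cV[R]_d -> 'cV[R]_d) := measurable_snd.
have m2x := measurable_subv x _ _ _ m2.
apply: measurable_funM; first exact: (measurableT_comp (measurable_sqrt R) m1).
apply: measurable_funD => //; apply: measurable_funD.
  exact: measurable_qform.
by apply: measurable_dotv => //; exact: measurable_cst.
Qed.

Definition kernel_constant x y : R :=
  2 `^ (d%:R / 2) * (\det (S x)) `^ (1 / 4) * (\det (S y)) `^ (1 / 4) /
  Num.sqrt (\det (Apar S M x y)).

(** The conditional mean of Z(x) Z(y) given (V, U) = [p]. *)
Definition kernel_density x y p : R :=
  amplitude x p * amplitude y p *
  expR (- (sample_time x p - sample_time y p) ^+ 2).

Lemma measurable_kernel_density x y :
  measurable_fun setT (kernel_density x y).
Proof.
apply: measurable_funM.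
  by apply: measurable_funM; exact: measurable_amplitude.
apply: measurableT_comp => //; apply: measurableT_comp => //.
apply: measurable_funX; apply: measurable_funB.
  exact: measurable_sample_time.
exact: measurable_sample_time.
Qed.

Lemma kernel_density_ge0 x y p : 0 <= kernel_density x y p.
Proof.
apply: mulr_ge0; last exact: expR_ge0.
by apply: mulr_ge0; exact: amplitude_ge0.
Qed.

Lemma kernel_densityE x y v u : 0 < v ->
  kernel_density x y (v, u) * f u =
  (2 * v / pi) `^ (d%:R / 2) * (\det (S x)) `^ (1 / 4) *
  (\det (S y)) `^ (1 / 4) *
  (g v x * g v y * expR (- v * Qpar S xi2 M z x y)) *
  expR (- qform (v *: Apar S M x y) (u - gauss_center S xi2 M z x y)).
Proof.
move=> v0; rewrite /kernel_density /amplitude /sample_time/= !gposE//.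
have K0 : 0 <= 2 * v / pi by rewrite divr_ge0 ?mulr_ge0 ?pi_ge0 ?ltW.
have -> : (2 * v / pi) `^ (d%:R / 2) =
    (2 * v / pi) `^ (d%:R / 4) * (2 * v / pi) `^ (d%:R / 4).
  rewrite -powRD; first by congr (_ `^ _); field.
  by apply/implyP => _; rewrite gt_eqF// divr_gt0 ?mulr_gt0 ?pi_gt0.
have f0 : Num.sqrt (f u) != 0 by rewrite gt_eqF// sqrtr_gt0.
have fE : f u = Num.sqrt (f u) ^+ 2 by rewrite sqr_sqrtr ?ltW.
rewrite [X in _ * X = _]fE.
(* This is [complete_square] multiplied by [v] and exponentiated, solved for the factor containing
   Q; the factor sqrt(v) in the sample times supplies the [v] in front of the squared difference. *)
have -> : expR (- v * Qpar S xi2 M z x y) =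
    expR (- v * qform (S x) (u - x)) * expR (- v * qform (S y) (u - y)) *
    expR (- (Num.sqrt v * (xi1 M z (u - x) + xi2 x) -
      Num.sqrt v * (xi1 M z (u - y) + xi2 y)) ^+ 2) /
    expR (- qform (v *: Apar S M x y) (u - gauss_center S xi2 M z x y)).
  apply/eqP; rewrite eq_sym; apply/eqP.
  rewrite -mulrBr exprMn sqr_sqrtr ?ltW// -!expRD -expRN -expRD; congr expR.
  have := @complete_square _ _ S xi2 M z Spos Msym x y u.
  rewrite qformZ => /(congr1 (fun t => v * t)) E.
  rewrite opprK.
  by lra.
by field; rewrite f0 expR_eq0.
Qed.

(** With V frozen, the law of U is replaced by f times Lebesgue measure; [f] cancels against the
    amplitudes, and a Gaussian integral with matrix V A is left. *)
Lemma integral_kernel_density x y :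
  (\int[P]_w (kernel_density x y (V w, U w))%:E =
   (kernel_constant x y)%:E *
   \int[P]_w (g (V w) x * g (V w) y *
              expR (- V w * Qpar S xi2 M z x y))%:E)%E.
Proof.
have [mf f_ge0 fE] := Uf.
have mk := measurable_kernel_density x y.
rewrite (@ge0_integral_independent _ _ _ _ _ _ _ P V U VU
  (fun p => (kernel_density x y p)%:E)); last 2 first.
- exact/measurable_EFinP.
- by move=> p; rewrite lee_fin kernel_density_ge0.
have Ap := @Apar_posdef _ _ S M Spos Msym x y.
have D0 := posdefmx_det_gt0 _ _ _ Ap.
rewrite -ge0_integralZl//; last 3 first.
- rewrite (_ : (fun w => _) = (fun w => (gpos x (V w) * gpos y (V w) *
      expR (- V w * Qpar S xi2 M z x y))%:E)); last first.
    by apply/funext => w; rewrite !gposE.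
  have mg t : measurable_fun setT (fun w => gpos t (V w)).
    exact: (measurableT_comp (measurable_gpos t)).
  apply/measurable_EFinP/measurable_funM; first exact: measurable_funM.
  apply: measurableT_comp => //; apply: measurable_funM => //.
  exact: measurableT_comp.
- by move=> w _; rewrite lee_fin !mulr_ge0 ?expR_ge0// ltW// g_gt0.
- by rewrite lee_fin !mulr_ge0 ?powR_ge0// invr_ge0 sqrtr_ge0.
apply: eq_integral => w _; have v0 := V_gt0 w.
have mkw : measurable_fun setT (fun u => (kernel_density x y (V w, u))%:E).
  by apply/measurable_EFinP; exact: measurableT_comp.
rewrite -(@ge0_integral_distribution _ _ _ _ _ P U
  (fun u => (kernel_density x y (V w, u))%:E))//; last first.
  by move=> u; rewrite lee_fin kernel_density_ge0.
rewrite (@ge0_integral_density _ _ _ (lebesgue_cV d) _ f)//; last first.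
  by move=> u; rewrite lee_fin kernel_density_ge0.
under eq_integral do rewrite -EFinM kernel_densityE// EFinM.
rewrite ge0_integralZl//; last 2 first.
- exact: measurable_expR_qform.
- by rewrite lee_fin !mulr_ge0 ?powR_ge0 ?expR_ge0// ltW// g_gt0.
rewrite gaussian_integral; last exact: posdefmxZ.
rewrite -!EFinM /kernel_constant detZ; congr EFin.
move: (gaussian_constant _ d _ _ v0 D0).
set a := (_ `^ (d%:R / 2)); set b := Num.sqrt (_ / _) => ab.
transitivity (a * b * (\det (S x) `^ (1 / 4) * \det (S y) `^ (1 / 4) *
  (g (V w) x * g (V w) y * expR (- V w * Qpar S xi2 M z x y)))); first by ring.
by rewrite ab; ring.
Qed.

End covariance_kernel.

(** Square integrability of Z(x) is part of the conclusion, so that the covariance in the formula is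
    a genuine one. *)
Theorem mainTheorem2 (R : realType) (dT : measure_display)
    (T : measurableType dT) (P : probability T R)
    (d : nat) (d_gt0 : (0 < d)%N)
    (V : {RV P >-> R}) (V_gt0 : forall w, 0 < V w)
    (U : {RV P >-> 'cV[R]_d}) (f : 'cV[R]_d -> R)
    (f_gt0 : forall u, 0 < f u) (Uf : has_density P U f)
    (Y : R -> T -> R)
    (Ystat : centered_stationary P Y (fun t => expR (- t ^+ 2)))
    (VUY : independent_with_process P V U Y)
    (S : 'cV[R]_d -> 'M[R]_d) (Spos : forall x, posdefmx (S x))
    (xi2 : 'cV[R]_d -> R)
    (g : R -> 'cV[R]_d -> R)
    (g_gt0 : forall (v : R) x, 0 < v -> 0 < g v x)
    (g_meas : forall x, measurable_fun (`]0, +oo[ : set R) (fun v => g v x))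
    (g_sqr : forall x, ('E_P[fun w => (g (V w) x ^+ 2)%R] < +oo)%E)
    (M : 'M[R]_d) (Msym : M^T = M) (z : 'cV[R]_d) :
  let Z := Zfield P V U Y f S xi2 g M z in
  (forall x, Z x \in Lfun P 2%:E) /\
  (forall x y,
     covariance P (Z x) (Z y) =
     ((2 `^ (d%:R / 2) * (\det (S x)) `^ (1 / 4) * (\det (S y)) `^ (1 / 4) /
       Num.sqrt (\det (Apar S M x y)))%:E *
      'E_P[fun w => (g (V w) x * g (V w) y *
                    expR (- V w * Qpar S xi2 M z x y))%R])%E).
Proof.
have [G [sG Gm mY VUG]] := VUY.
have GT : G setT by case: sG => G0 GC _; rewrite -(setD0 setT); exact: GC.
pose W := pair_mfun _ _ _ _ _ _ V U.
have WG := @independent3_pair _ _ _ _ _ _ _ P V U G Gm VUG GT.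
have VU := @independent3_pair12 _ _ _ _ _ _ _ P V U G VUG GT.
pose a := amplitude f S g; pose t := sample_time xi2 M z.
have ma x : measurable_fun setT (a x).
  exact: (measurable_amplitude U f f_gt0 Uf S g g_meas).
have mt x : measurable_fun setT (t x) by exact: measurable_sample_time.
move=> Z.
have ZE x : Z x = fun w => a x (W w) * Y (t x (W w)) w.
  apply/funext => w; rewrite /Z /Zfield /a /t /amplitude /sample_time /W /=.
  by rewrite gposE// mulrAC.
have mZ x : measurable_fun setT (Z x).
  rewrite ZE; apply: measurable_funM.
    exact: (measurableT_comp (ma x) (measurable_funP W)).
  (* Measurability at the random time comes from joint measurability of [Y] with respect to [G]. *)
  exact: (measurable_random_time _ _ _ _ _ W _ sG Gm _ mY _ (mt x)).
have maa x y : measurable_fun setT (fun p => a x p * a y p).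
  exact: measurable_funM.
have ZZE x y w : Z x w * Z y w = a x (W w) * a y (W w) *
    (Y (t x (W w)) w * Y (t y (W w)) w) by rewrite !ZE mulrACA.
have kE x y : (\int[P]_w (a x (W w) * a y (W w) *
    expR (- (t x (W w) - t y (W w)) ^+ 2))%:E =
    (kernel_constant S M x y)%:E * 'E_P[fun w => (g (V w) x * g (V w) y *
                    expR (- V w * Qpar S xi2 M z x y))%R])%E.
  rewrite unlock.
  exact: (integral_kernel_density V U f V_gt0 f_gt0 Uf S xi2 M z g).
have Z2 x : Z x \in Lfun P 2%:E.
  apply: integrable_sqr_Lfun2 => //.
  under eq_integral do rewrite expr2 ZZE.
  rewrite (ge0_random_time_moment2 _ _ _ _ _ _ W _ sG Gm WG _ _ mY Ystat
    _ _ _ (maa x x) (mt x) (mt x))//; last first.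
    by move=> p; rewrite -expr2 sqr_ge0.
  rewrite kE unlock.
  (* On the diagonal c, m and x - y all vanish, so Q = 0 and the expectation reduces to the finite
     second moment of g(V, x). *)
  under eq_integral.
    move=> w _; rewrite (_ : Qpar _ _ _ _ _ _ = 0); last first.
      rewrite /Qpar /cpar /mpar subrr !qformE !mulmx0 !dotv0r.
      by rewrite oppr0 add0r subrr expr0n subrr addr0.
    rewrite mulr0 expR0 mulr1 -expr2.
    over.
  have := g_sqr x; rewrite unlock => gx.
  by rewrite lte_mul_pinfty// lee_fin !mulr_ge0 ?powR_ge0 ?invr_ge0 ?sqrtr_ge0.
split=> // x y.
have Z1 u : Z u \in Lfun P 1 by rewrite Lfun_subset12 ?fin_num_measure.
have ZZ := Lfun2_mul_Lfun1 (Z2 x) (Z2 y).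
have EZ u : ('E_P[Z u] = 0)%E.
  rewrite unlock ZE.
  apply: (random_time_moment1 _ _ _ _ _ _ W _ sG Gm WG _ _ mY Ystat
    _ _ (ma u) (mt u)).
  by have /Lfun1_integrable := Z1 u; rewrite ZE.
rewrite covarianceE// !EZ mule0 sube0 -kE unlock.
under eq_integral do rewrite fctE ZZE.
apply: (random_time_moment2 _ _ _ _ _ _ W _ sG Gm WG _ _ mY Ystat
    _ _ _ (maa x y) (mt x) (mt y)).
have /Lfun1_integrable := ZZ; apply: eq_integrable => // w _ /=.
by rewrite ZZE.
Qed.
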